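(* Let $\mathscr V$ be a variety of topological algebras of signature $\Sigma$. Then $\mathscr V$ is congruence-permutable if and only if there exists a Mal'tsev term in the language of $\mathscr V$, that is, a term $\mu(x,y,z)$ in three variables over $\Sigma$ such that the identities $x=\mu(x,y,y)$ and $x=\mu(y,y,x)$ hold in every algebra belonging to $\mathscr V$.
   Context: A signature $\Sigma$ is a set of operation symbols, each with a finite arity $n\ge 0$. A $\Sigma$-algebra is a nonempty set $A$ with an operation $\sigma\colon A^n\to A$ for each $n$-ary symbol $\sigma\in\Sigma$. A topological $\Sigma$-algebra is a $\Sigma$-algebra with a topology (no separation axioms assumed) for which all these operations are continuous. A congruence on an algebra is an equivalence relation compatible with all operations. A topological subalgebra is a subalgebra with the induced topology. The topological quotient of $A$ by a congruence $\sim$ is $A/{\sim}$ with the quotient topology, provided that the operations of $A/{\sim}$ are continuous with respect to this topology. A variety of topological algebras is a class of topological algebras of the same signature closed under the formation of topological products, topological quotients, and (topological) subalgebras (algebras being considered up to topological isomorphism). A variety is congruence-permutable if any two congruences of any algebra in the variety commute under composition of relations. *)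

(* Defs.v *)
From HB Require Import structures.
From mathcomp Require Import all_boot generic_quotient.
From mathcomp Require Import boolp classical_sets functions topology.

Set Implicit Arguments.
Unset Strict Implicit.
Unset Printing Implicit Defensive.

Local Open Scope classical_set_scope.
Local Open Scope quotient_scope.

Record signature := Signature { symbol : Type; arity : symbol -> nat }.

(* [{ptws 'I_n -> A}] is the set of functions from ['I_n] to [A] with the
   product topology, that is, the topological power [A ^ n]. *)
Record topAlgebra (S : signature) := TopAlgebra {
  carrier :> topologicalType;
  carrier_inhabited : inhabited carrier;
  op : forall s : symbol S, {ptws 'I_(arity s) -> carrier} -> carrier;
  op_continuous : forall s, continuous (@op s)
}.

Arguments op {S} t s _.

Section continuity_into_initial_topologies.

Lemma continuous_initial (Z T : topologicalType) (X : choiceType) (f : X -> T)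
    (h : Z -> initial_topology f) :
  continuous (f \o h) -> continuous h.
Proof.
move=> /continuousP fh; apply/continuousP => _ [U oU <-].
by have := fh _ oU.
Qed.

Lemma continuous_into_product (Z : topologicalType) (I : Type)
    (T : I -> topologicalType) (h : Z -> prod_topology T) :
  (forall i, continuous (fun z => h z i)) -> continuous h.
Proof.
move=> hi z; apply/cvg_sup => i.
exact: (@continuous_initial Z (T i) _ (fun f : forall i, T i => f i) h (hi i) z).
Qed.

Lemma continuous_eval (I : Type) (T : I -> topologicalType) (i : I) :
  continuous (fun f : prod_topology T => f i).
Proof.
move=> f.
have /cvg_sup/(_ i) fi : (f : prod_topology T) --> f by exact: cvg_id.
exact: (cvg_trans (cvg_app _ fi) (@initial_continuous _ _ _ f)).
Qed.

End continuity_into_initial_topologies.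

Section product.
Variables (S : signature) (I : Type) (A : I -> topAlgebra S).

Let P : topologicalType := prod_topology (fun i => carrier (A i)).

Definition prod_op (s : symbol S) (f : {ptws 'I_(arity s) -> P}) : P :=
  fun i => op (A i) s (fun k => f k i).

Lemma prod_inhabited : inhabited P.
Proof.
constructor=> i.
apply: (@sval _ (fun=> True)); apply: cid.
by have [a] := carrier_inhabited (A i); exists a.
Qed.

Lemma prod_op_continuous s : continuous (@prod_op s).
Proof.
apply: continuous_into_product => i f.
apply: (@continuous_comp _ _ _
  (fun f : {ptws 'I_(arity s) -> P} =>
     (fun k => f k i) : {ptws 'I_(arity s) -> A i}) (op (A i) s)); last first.
  exact: op_continuous.
apply: continuous_into_product => k {}f.
apply: (@continuous_comp _ _ _ (fun f : {ptws 'I_(arity s) -> P} => f k)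
  (fun p : P => p i)); exact: continuous_eval.
Qed.

Definition prodAlgebra : topAlgebra S :=
  TopAlgebra prod_inhabited prod_op_continuous.

End product.

Section subalgebra.
Variables (S : signature) (A : topAlgebra S) (B : set A).

Definition op_closed := forall (s : symbol S) (f : 'I_(arity s) -> A),
  (forall k, B (f k)) -> B (op A s f).

Hypotheses (B0 : B !=set0) (Bop : op_closed).

Lemma sub_op_subproof (s : symbol S) (f : 'I_(arity s) -> set_type B) :
  op A s (fun k => val (f k)) \in B.
Proof. by apply/mem_set/Bop => k; exact: set_valP. Qed.

Definition sub_op (s : symbol S) (f : {ptws 'I_(arity s) -> set_type B}) :
  set_type B := exist _ (op A s (fun k => val (f k))) (sub_op_subproof f).

Lemma sub_inhabited : inhabited (set_type B).
Proof. by case: B0 => b /mem_set Bb; constructor; exists b. Qed.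

Lemma sub_op_continuous s : continuous (@sub_op s).
Proof.
apply: (@continuous_initial _ A _ (fun x : set_type B => val x)) => f.
apply: (@continuous_comp _ _ _
  (fun f : {ptws 'I_(arity s) -> set_type B} =>
     (fun k => val (f k)) : {ptws 'I_(arity s) -> A}) (op A s)); last first.
  exact: op_continuous.
apply: continuous_into_product => k {}f.
apply: (@continuous_comp _ _ _
  (fun f : {ptws 'I_(arity s) -> set_type B} => f k)
  (fun b : set_type B => val b)); first exact: continuous_eval.
exact: initial_continuous.
Qed.

Definition subAlgebra : topAlgebra S :=
  TopAlgebra sub_inhabited sub_op_continuous.

End subalgebra.

Record congruence (S : signature) (A : topAlgebra S) := Congruence {
  cong_rel :> equiv_rel A;
  cong_op : forall (s : symbol S) (f g : 'I_(arity s) -> A),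
    (forall k, cong_rel (f k) (g k)) -> cong_rel (op A s f) (op A s g)
}.

Section quotient.
Variables (S : signature) (A : topAlgebra S) (e : congruence A).

Definition quot_space : topologicalType := quotient_topology {eq_quot e}.

Definition quot_op (s : symbol S) (f : {ptws 'I_(arity s) -> quot_space}) :
  quot_space := \pi_({eq_quot e}) (op A s (fun k => repr (f k))).

Lemma quot_opE (s : symbol S) (f : 'I_(arity s) -> A) :
  quot_op (fun k => \pi_({eq_quot e}) (f k) : quot_space) =
  \pi_({eq_quot e}) (op A s f).
Proof.
apply/eqmodP/cong_op => k.
by rewrite -[cong_rel e _ _]eqmodE reprK.
Qed.

Lemma quot_inhabited : inhabited quot_space.
Proof.
by have [a] := carrier_inhabited A; constructor; exact: (\pi_({eq_quot e}) a).
Qed.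

(* The operations induced on the quotient space need not be continuous, so the
   topological quotient exists only under this hypothesis. *)
Hypothesis quot_op_continuous : forall s, continuous (@quot_op s).

Definition quotAlgebra : topAlgebra S :=
  TopAlgebra quot_inhabited quot_op_continuous.

End quotient.

Definition top_isomorphic (S : signature) (A B : topAlgebra S) : Prop :=
  exists (f : A -> B) (g : B -> A),
    [/\ cancel f g, cancel g f, continuous f, continuous g &
        forall (s : symbol S) (a : 'I_(arity s) -> A),
          f (op A s a) = op B s (fun k => f (a k))].

Record is_variety (S : signature) (V : topAlgebra S -> Prop) : Prop := {
  variety_iso : forall A B, top_isomorphic A B -> V A -> V B;
  variety_prod : forall (I : Type) (A : I -> topAlgebra S),
    (forall i, V (A i)) -> V (prodAlgebra A);
  variety_sub : forall (A : topAlgebra S) (B : set A)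
    (B0 : B !=set0) (Bop : op_closed B), V A -> V (subAlgebra B0 Bop);
  variety_quot : forall (A : topAlgebra S) (e : congruence A)
    (ec : forall s, continuous (@quot_op S A e s)), V A -> V (quotAlgebra ec)
}.

Definition rel_comp (T : Type) (r1 r2 : rel T) (x y : T) : Prop :=
  exists z, r1 x z /\ r2 z y.

(* The congruences are those of the underlying algebra: no compatibility with
   the topology is required. *)
Definition congruence_permutable (S : signature) (V : topAlgebra S -> Prop) :=
  forall A, V A -> forall (e1 e2 : congruence A) (x y : A),
    rel_comp e1 e2 x y <-> rel_comp e2 e1 x y.

Inductive term (S : signature) (X : Type) :=
| Var of X
| App (s : symbol S) of ('I_(arity s) -> term S X).

Arguments Var {S X} _.
Arguments App {S X} s _.

Fixpoint term_eval (S : signature) (X : Type) (A : topAlgebra S) (v : X -> A)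
    (t : term S X) : A :=
  match t with
  | Var x => v x
  | App s ts => op A s (fun k => term_eval v (ts k))
  end.

Definition term_eval3 (S : signature) (A : topAlgebra S) (t : term S 'I_3)
  (x y z : A) : A := term_eval (tnth [tuple x; y; z]) t.

Definition is_Maltsev_term (S : signature) (V : topAlgebra S -> Prop)
    (mu : term S 'I_3) : Prop :=
  forall A, V A -> forall x y : A,
    x = term_eval3 mu x y y /\ x = term_eval3 mu y y x.

(* Main.v *)
Require Import Defs.
From mathcomp Require Import all_boot.
From mathcomp Require Import generic_quotient boolp classical_sets topology.

(** The theorem is Mal'tsev's classical argument, carried out in a variety of
topological algebras. It goes through because congruences are taken in the
purely algebraic sense: they may be kernels of discontinuous homomorphisms, so
the quotients by them, which might not exist as topological algebras, never
have to be formed.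

If [mu] is a Mal'tsev term and [x e1 z e2 y], then [mu x z y] is the element
that witnesses [x e2 _ e1 y]: moving [z] to [y] along [e2] turns it into
[mu x y y = x], and moving [x] to [z] along [e1] turns it into
[mu z z y = y].

Conversely, the variety contains an algebra [F] generated by three elements
[x, y, z] and free on them in the algebraic sense (lemma
[exists_free_algebra]): every assignment of values in an algebra of the variety
extends to a homomorphism, not necessarily continuous. Let [h1] and [h2] be the
endomorphisms of [F] sending [(x, y, z)] to [(x, x, z)] and [(x, z, z)], and
let [ker] denote the kernel. Then [x (ker h1) y (ker h2) z], so permutability
gives [w] with [x (ker h2) w (ker h1) z]. As [F] is generated by [x, y, z],
[w = mu x y z] for some term [mu], and applying [h2] and [h1] to [w] gives
[x = mu x z z] and [mu x x z = z] in [F]. By freeness of [F] these are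
identities of the whole variety. *)

Set Implicit Arguments.
Unset Strict Implicit.
Unset Printing Implicit Defensive.

Section homomorphisms.
Variable S : signature.
Implicit Types A B : topAlgebra S.

(** Continuity is left out because the homomorphisms given by the freeness of
the algebra of terms need not be continuous. *)
Definition is_hom A B (h : A -> B) : Prop :=
  forall (s : symbol S) (a : 'I_(arity s) -> A),
    h (op A s a) = op B s (fun k => h (a k)).

Lemma hom_term_eval A B (h : A -> B) (X : Type) (v : X -> A) (t : term S X) :
  is_hom h -> h (term_eval v t) = term_eval (fun x => h (v x)) t.
Proof.
by move=> hh; elim: t => [//|s ts IH] /=; rewrite hh; congr op; apply/funext.
Qed.

Lemma hom_term_eval3 A B (h : A -> B) (t : term S 'I_3) (x y z : A) :
  is_hom h -> h (term_eval3 t x y z) = term_eval3 t (h x) (h y) (h z).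
Proof.
move=> hh; rewrite /term_eval3 hom_term_eval//; congr (term_eval _ t).
by apply/funext => -[[|[|[|//]]] ?].
Qed.

Lemma term_eval_cong A (e : congruence A) (X : Type) (v w : X -> A)
    (t : term S X) :
  (forall x, e (v x) (w x)) -> e (term_eval v t) (term_eval w t).
Proof. by move=> evw; elim: t => [//|s ts IH] /=; exact: cong_op. Qed.

Lemma term_eval3_cong A (e : congruence A) (t : term S 'I_3)
    (x y z x' y' z' : A) :
  e x x' -> e y y' -> e z z' -> e (term_eval3 t x y z) (term_eval3 t x' y' z').
Proof. by move=> ? ? ?; apply: term_eval_cong => -[[|[|[|//]]] ?]. Qed.

Section kernel.
Variables (A B : topAlgebra S) (h : A -> B) (hh : is_hom h).

Let ker : rel A := fun a b => h a == h b.

Let ker_refl : reflexive ker.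
Proof. by move=> a; rewrite /ker. Qed.

Let ker_sym : symmetric ker.
Proof. by move=> a b; rewrite /ker eq_sym. Qed.

Let ker_trans : transitive ker.
Proof. by move=> b a c; rewrite /ker => /eqP ->. Qed.

Let ker_equiv : equiv_rel A := EquivRel ker ker_refl ker_sym ker_trans.

Let ker_op (s : symbol S) (f g : 'I_(arity s) -> A) :
  (forall k, ker_equiv (f k) (g k)) -> ker_equiv (op A s f) (op A s g).
Proof.
move=> fg; apply/eqP; rewrite !hh; congr op.
by apply/funext => k; apply/eqP; exact: fg.
Qed.

Definition kernel_congruence : congruence A := Congruence ker_op.

Lemma kernel_congruenceP (a b : A) : kernel_congruence a b <-> h a = h b.
Proof. by split => /eqP. Qed.

End kernel.

End homomorphisms.

Section free_algebra.
Variables (S : signature) (V : topAlgebra S -> Prop) (hV : is_variety V).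
Variables (X : Type) (x0 : X).

Let T := term S X.

Definition is_identity (t u : T) : Prop :=
  forall A, V A -> forall v : X -> A, term_eval v t = term_eval v u.

(** The algebra and the valuation are packed in a sigma-type in [Type], so that
they serve as the factors of a product indexed by [p]. *)
Lemma exists_counterexample (p : {tu : T * T | ~ is_identity tu.1 tu.2}) :
  {Av : {A : topAlgebra S & X -> A} |
    V (projT1 Av) /\
    term_eval (projT2 Av) (sval p).1 <> term_eval (projT2 Av) (sval p).2}.
Proof.
case: p => -[t u] /= ntu; apply: cid; apply: contrapT => noA; apply: ntu.
move=> A VA v; apply: contrapT => tu; apply: noA.
by exists (existT _ A v).
Qed.

(** The members of [V] form a proper class, so their product is not available.
It is enough to take one factor for each pair of terms that is not an identity
of [V], namely an algebra in which some valuation of [X] tells the two terms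
apart. In the product, with each variable interpreted by the family of its
values in the factors, two terms agree only if they agree in all of [V]; hence
the subalgebra of the values of terms is free. The element [x0] ensures that it
is nonempty when the signature has no constants. The homomorphisms out of it
extending a given valuation evaluate any term representing an element; nothing
makes them continuous. *)
Lemma exists_free_algebra :
  exists (F : topAlgebra S) (gen : X -> F),
    [/\ V F, forall w, exists t, w = term_eval gen t &
        forall A, V A -> forall v : X -> A,
          exists h : F -> A, is_hom h /\ forall x, h (gen x) = v x].
Proof.
pose factor p := projT1 (sval (exists_counterexample p)).
pose P := prodAlgebra factor.
pose g : X -> P := fun x p => projT2 (sval (exists_counterexample p)) x.
have VP : V P.
  by apply: variety_prod => // p; case: (svalP (exists_counterexample p)).
have g_inj t u : term_eval g t = term_eval g u -> is_identity t u.
  move=> tu; apply: contrapT => ntu; pose p := exist _ (t, u) ntu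
    : {tu : T * T | ~ is_identity tu.1 tu.2}.
  have [_ /=] := svalP (exists_counterexample p); apply.
  have proj_hom : is_hom ((fun f => f p) : P -> factor p) by [].
  have /(congr1 (fun f : P => f p)) := tu.
  by rewrite !(hom_term_eval _ _ proj_hom).
pose B : set P := fun f => exists t, f = term_eval g t.
have Bgen x : B (g x) by exists (Var x).
have B0 : (B !=set0)%classic by exists (g x0).
have Bop : op_closed B.
  move=> s f /choice[ts fE]; exists (App s ts).
  by have -> : f = (fun k => term_eval g (ts k)) by exact/funext.
pose F := subAlgebra B0 Bop.
have val_hom : is_hom ((fun w => val w) : F -> P) by [].
pose gen x : F := exist _ (g x) (mem_set (Bgen x)).
have val_eval t : val (term_eval gen t : F) = term_eval g t.
  exact: (hom_term_eval _ _ val_hom).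
have F_gen (w : F) : exists t, w = term_eval gen t.
  by have [t wt] := set_valP w; exists t; apply/val_inj; rewrite val_eval -wt.
have [rep repE] := choice F_gen.
have rep_eval t : is_identity (rep (term_eval gen t)) t.
  by apply: g_inj; rewrite -!val_eval -repE.
exists F, gen; split=> [|//|A VA v]; first exact: variety_sub.
exists (fun w => term_eval v (rep w)); split=> [s a|x].
  have -> : op F s a = term_eval gen (App s (fun k => rep (a k))).
    by have {1}-> : a = (fun k => term_eval gen (rep (a k))) by exact/funext.
  exact: rep_eval.
exact: (rep_eval (Var x)).
Qed.

End free_algebra.

Lemma exists_free_algebra3 (S : signature) (V : topAlgebra S -> Prop) :
  is_variety V ->
  exists (F : topAlgebra S) (x y z : F),
    [/\ V F, forall w, exists t, w = term_eval3 t x y z &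
        forall A, V A -> forall a b c : A,
          exists h : F -> A, is_hom h /\ [/\ h x = a, h y = b & h z = c]].
Proof.
move=> hV.
have [F [gen [VF F_gen F_free]]] := exists_free_algebra hV (ord0 : 'I_3).
exists F, (gen (inord 0)), (gen (inord 1)), (gen (inord 2)).
split=> [//|w|A VA a b c].
  have [t ->] := F_gen w; exists t; rewrite /term_eval3; congr (term_eval _ t).
  apply/funext => i; rewrite (tnth_nth (gen i)).
  by case: i => -[|[|[|//]]] ? /=; congr gen; apply/val_inj; rewrite /= inordK.
have [h [hh hE]] := F_free A VA (tnth [tuple a; b; c]).
by exists h; split=> //; rewrite !hE !(tnth_nth a) !inordK.
Qed.

(** The witness [mu x z y] is related to [mu x y y = x] by [e2] and to
[mu z z y = y] by [e1]. *)
Lemma Maltsev_term_permutes (S : signature) (A : topAlgebra S)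
    (mu : term S 'I_3) (e1 e2 : congruence A) (x y : A) :
  (forall a b : A, a = term_eval3 mu a b b /\ a = term_eval3 mu b b a) ->
  rel_comp e1 e2 x y -> rel_comp e2 e1 x y.
Proof.
move=> mal [z [xz zy]]; exists (term_eval3 mu x z y); split.
  rewrite {1}(mal x y).1; apply: term_eval3_cong; rewrite ?equiv_refl//.
  by rewrite equiv_sym.
rewrite {2}(mal y z).2.
by apply: term_eval3_cong; rewrite ?equiv_refl.
Qed.

Theorem theoremA (S : signature) (V : topAlgebra S -> Prop)
    (hV : is_variety V) :
  congruence_permutable V <-> exists mu : term S 'I_3, is_Maltsev_term V mu.
Proof.
split=> [perm|[mu mal] A VA e1 e2 x y]; last first.
  by split; exact: (Maltsev_term_permutes (mal A VA)).
have [F [x [y [z [VF F_gen F_free]]]]] := exists_free_algebra3 hV.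
have [h1 [h1_hom [h1x h1y h1z]]] := F_free F VF x x z.
have [h2 [h2_hom [h2x h2y h2z]]] := F_free F VF x z z.
have [|w [/kernel_congruenceP xw /kernel_congruenceP wz]] :=
  (perm F VF (kernel_congruence h1_hom) (kernel_congruence h2_hom) x z).1.
  by exists y; split; apply/kernel_congruenceP; rewrite ?h1x ?h1y ?h2y ?h2z.
(* [xw] and [wz] become the two identities at the generators of [F]; the
homomorphisms [h] below carry them to arbitrary elements [a] and [b]. *)
have [mu wE] := F_gen w; exists mu => A VA a b.
rewrite wE !hom_term_eval3// ?h1x ?h1y ?h1z ?h2x ?h2y ?h2z in xw wz.
split.
  have [h [hh [hx _ hz]]] := F_free A VA a b b.
  by have := congr1 h xw; rewrite hom_term_eval3// hx hz.
have [h [hh [hx _ hz]]] := F_free A VA b b a.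
by have := congr1 h wz; rewrite hom_term_eval3// hx hz.
Qed.
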